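(* Let $p\ge2$ be an integer, let $H$ be a $p$-star, let $\epsilon\in[0,1]$ and $\beta_2\in\mathbb{R}$. Then every optimizing graphon of the variational problem $$\psi(\epsilon,\beta_2)=\sup\left\{\beta_2 t(H,h)-\frac12\iint_{[0,1]^2}I(h(x,y))\,dx\,dy\;:\;h\text{ a graphon},\ \iint_{[0,1]^2}h(x,y)\,dx\,dy=\epsilon\right\}$$ is multipodal.
   Context: A graphon is a measurable function $h:[0,1]^2\to[0,1]$ with $h(x,y)=h(y,x)$. $I(x)=x\log x+(1-x)\log(1-x)$ on $[0,1]$, with $0\log 0=0$. The $p$-star is the graph with $p+1$ vertices and $p$ edges, all of which share one common vertex; for it the homomorphism density is $t(H,h)=\int_0^1\left(\int_0^1 h(x,y)\,dy\right)^p dx$. An optimizing graphon is a graphon with $\iint h=\epsilon$ attaining the supremum in the definition of $\psi(\epsilon,\beta_2)$. A graphon $h$ is multipodal if there is a partition of $[0,1]$ into finitely many measurable sets $A_1,\dots,A_m$ such that $h$ is a.e. constant on each product $A_i\times A_j$. *)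

(* Defs.v *)
From HB Require Import structures.
From mathcomp Require Import all_boot all_order all_algebra.
From mathcomp Require Import all_classical all_reals all_analysis.
Set Implicit Arguments.
Unset Strict Implicit.
Unset Printing Implicit Defensive.
Import Order.TTheory GRing.Theory Num.Theory.
Import numFieldNormedType.Exports.
Local Open Scope classical_set_scope.
Local Open Scope ring_scope.

Definition unit_interval (R : realType) : set (measurableTypeR R) :=
  `[0, 1]%classic.
Arguments unit_interval : clear implicits.

Definition unit_square (R : realType) :
    set (measurableTypeR R * measurableTypeR R) :=
  unit_interval R `*` unit_interval R.
Arguments unit_square : clear implicits.

Definition lebesgue2 (R : realType) :=
  (@lebesgue_measure R \x @lebesgue_measure R)%E.
Arguments lebesgue2 : clear implicits.

(* Graphons are total functions on the plane of which only the values on the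
   unit square matter; measurability is Borel measurability. *)
Definition graphon (R : realType) (h : R * R -> R) : Prop :=
  [/\ measurable_fun (unit_square R) h,
      (forall z, unit_square R z -> 0 <= h z <= 1)
    & (forall x y, unit_square R (x, y) -> h (x, y) = h (y, x))].

(* The convention 0 log 0 = 0 holds since [0 * _ = 0]. *)
Definition entropyI (R : realType) (x : R) : R :=
  x * ln x + (1 - x) * ln (1 - x).

Definition edge_density (R : realType) (h : R * R -> R) : R :=
  \int[lebesgue2 R]_(z in unit_square R) h z.

Definition star_density (R : realType) (p : nat) (h : R * R -> R) : R :=
  \int[@lebesgue_measure R]_(x in unit_interval R)
    (\int[@lebesgue_measure R]_(y in unit_interval R) h (x, y)) ^+ p.

Definition objective (R : realType) (p : nat) (beta2 : R) (h : R * R -> R)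
    : R :=
  beta2 * star_density p h
  - 2^-1 * \int[lebesgue2 R]_(z in unit_square R) entropyI (h z).

Definition psi (R : realType) (p : nat) (eps beta2 : R) : \bar R :=
  ereal_sup [set (objective p beta2 h)%:E | h in
    [set h : R * R -> R | graphon h /\ edge_density h = eps]].

Definition optimizing_graphon (R : realType) (p : nat) (eps beta2 : R)
    (h : R * R -> R) : Prop :=
  [/\ graphon h, edge_density h = eps
    & (objective p beta2 h)%:E = psi p eps beta2].

(* [partition] also asks the blocks to be nonempty, which is harmless. *)
Definition multipodal (R : realType) (h : R * R -> R) : Prop :=
  exists (m : nat) (A : 'I_m -> set (measurableTypeR R)),
    [/\ partition [set: 'I_m] A (unit_interval R),
        (forall i, measurable (A i))
      & forall i j, exists c : R,
          {ae lebesgue2 R, forall z, (A i `*` A j) z -> h z = c}].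

(* Main.v *)
Require Import Defs.
From HB Require Import structures.
From mathcomp Require Import all_boot all_order all_algebra.
From mathcomp Require Import all_classical all_reals all_analysis.
From mathcomp Require Import measurable_realfun.
From mathcomp Require Import ring lra.
Set Implicit Arguments.
Unset Strict Implicit.
Unset Printing Implicit Defensive.
Import Order.TTheory GRing.Theory Num.Theory.
Import numFieldNormedType.Exports.
Local Open Scope classical_set_scope.
Local Open Scope ring_scope.

(* Let [h] be optimal with density strictly between 0 and 1, let [d] be its
   degree function and [c = beta2 * p].  The Gibbs graphon
   [g (x, y) = (1 + K e^(- c (d x ^ (p-1) + d y ^ (p-1))))^-1], where [K] is
   fixed by the density constraint, maximizes the concave functional obtained
   by linearizing the star density at [h].  Comparing [h] with
   [(1 - s) h + s g] for small [s], and using only the convexity of the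
   entropy, forces the Gibbs gap between [h] and [g] to have integral zero, so
   [h = g] almost everywhere; the entropy is never differentiated at [h], which
   could a priori take the values 0 and 1.
   Hence [w x = e^(- c d x ^ (p-1))] satisfies, for almost every [x], the
   equation [ln w + c G w ^ (p-1) = 0], where
   [G t = \int (1 + K w(y) t)^-1 dy].  The left side is real analytic on the
   positive half-line and unbounded at infinity, so it has finitely many zeros
   in a compact interval: [w] takes finitely many values, and [h (x, y)] is a
   function of [w x] and [w y]. *)

(** * Elementary inequalities for powers and for the entropy *)

(** By induction: the first-order remainder at exponent [n.+2] is [b] times the one at [n.+1] plus
    [n.+1%:R * a ^+ n * (b - a) ^+ 2]. It makes the error of linearizing the star density
    quadratic. *)
Lemma expr_taylor_bound (R : realType) (n : nat) (a b : R) :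
  0 <= a <= 1 -> 0 <= b <= 1 ->
  `|b ^+ n.+1 - a ^+ n.+1 - n.+1%:R * a ^+ n * (b - a)|
    <= n.+1%:R ^+ 2 * (b - a) ^+ 2.
Proof.
move=> a01 b01; elim: n => [|n IH].
  have -> : b ^+ 1 - a ^+ 1 - 1%:R * a ^+ 0 * (b - a) = 0 by rewrite expr0;
    ring.
  by rewrite normr0 mulr_ge0 ?sqr_ge0.
have -> : b ^+ n.+2 - a ^+ n.+2 - n.+2%:R * a ^+ n.+1 * (b - a) =
    b * (b ^+ n.+1 - a ^+ n.+1 - n.+1%:R * a ^+ n * (b - a)) +
    n.+1%:R * a ^+ n * (b - a) ^+ 2.
  by rewrite !exprS -!natr1; ring.
apply: (le_trans (ler_normD _ _)).
have [a0 a1] := andP a01.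
have an : 0 <= a ^+ n <= 1 by rewrite exprn_ge0//= exprn_ile1.
have n0 : (0 : R) <= n.+1%:R by [].
apply: (@le_trans _ _
    (n.+1%:R ^+ 2 * (b - a) ^+ 2 + n.+1%:R * (b - a) ^+ 2)); last first.
  by rewrite -(natr1 n.+1); have := sqr_ge0 (b - a); nra.
apply: lerD.
  rewrite normrM ger0_norm; last by case/andP: b01.
  by apply: le_trans IH; rewrite ler_piMl ?normr_ge0//; case/andP: b01.
rewrite ger0_norm; last first.
  by apply: mulr_ge0 (sqr_ge0 _); apply: mulr_ge0 => //; case/andP: an.
by rewrite ler_wpM2r ?sqr_ge0// ler_piMr//; case/andP: an.
Qed.

(** This is [1 + t < expR t] at [t = ln (v / u)], multiplied by [u]; for [u = 0] the convention 0
    log 0 = 0 is used. The equality case is kept because uniqueness of the optimizer rests on it. *)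
Lemma ler_xlnx (R : realType) (u v : R) : 0 <= u -> 0 < v ->
  u - v <= u * ln u - u * ln v ?= iff (u == v).
Proof.
move=> u0 v0; apply/leifP; have [->|nuv] := eqVneq u v; first by rewrite !subrr.
have [->|un0] := eqVneq u 0; first by rewrite !mul0r subrr sub0r oppr_lt0.
have up : 0 < u by rewrite lt_neqAle eq_sym un0.
have : 1 + ln (v / u) < expR (ln (v / u)).
  apply: expR_gt1Dx; rewrite ln_eq0 ?divr_gt0//.
  by apply: contra_neq nuv => /(congr1 ( *%R^~ u)); rewrite mulfVK// mul1r.
rewrite lnK ?posrE ?divr_gt0// ln_div ?posrE// ltr_pdivlMr//.
by rewrite -subr_gt0 => H; rewrite -subr_gt0; apply: lt_le_trans H _; lra.
Qed.

(** Adding [ler_xlnx] for the pairs [u], [v] and [1 - u], [1 - v] cancels the linear terms. The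
    tangent is taken at the interior point [v], so [u] may be 0 or 1. *)
Lemma entropyI_tangent (R : realType) (u v : R) : 0 <= u <= 1 -> 0 < v < 1 ->
  entropyI v + (ln v - ln (1 - v)) * (u - v) <= entropyI u ?= iff (u == v).
Proof.
move=> /andP[u0 u1] /andP[v0 v1].
have v1' : 0 < 1 - v by rewrite subr_gt0.
have u1' : 0 <= 1 - u by rewrite subr_ge0.
apply/leifP; have [->|nuv] := eqVneq u v; first by rewrite subrr mulr0 addr0.
have /leifP := ler_xlnx u0 v0; rewrite (negbTE nuv) => H1.
have [H2 _] := ler_xlnx u1' v1'.
by rewrite /entropyI; nra.
Qed.

Lemma entropyI_bounded (R : realType) (u : R) : 0 <= u <= 1 ->
  `|entropyI u| <= 2.
Proof.
move=> /andP[u0 u1].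
have u1' : 0 <= 1 - u by rewrite subr_ge0.
have [H1 _] := ler_xlnx u0 ltr01; have [H2 _] := ler_xlnx u1' ltr01.
have L1 : u * ln u <= 0 by rewrite mulr_ge0_le0// ln_le0.
have L2 : (1 - u) * ln (1 - u) <= 0 by rewrite mulr_ge0_le0// ln_le0// gerBl.
rewrite !ln1 in H1 H2.
by rewrite /entropyI ler_norml; apply/andP; split; lra.
Qed.

(* The convex combinations are interior, so the tangent there is finite. *)
Lemma entropyI_convex (R : realType) (u v s : R) :
  0 <= u <= 1 -> 0 < v < 1 -> 0 < s <= 1 ->
  entropyI ((1 - s) * u + s * v) <= (1 - s) * entropyI u + s * entropyI v.
Proof.
move=> u01 v01 /andP[s0 s1]; set w := (1 - s) * u + s * v.
have [[u0 u1] [v0 v1]] := (andP u01, andP v01).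
have s1' : 0 <= 1 - s by rewrite subr_ge0.
have w01 : 0 < w < 1.
  apply/andP; split; first by rewrite ltr_wpDl ?mulr_ge0 ?mulr_gt0.
  rewrite -subr_gt0 (_ : 1 - w = (1 - s) * (1 - u) + s * (1 - v)).
    by rewrite ltr_wpDl ?mulr_ge0 ?mulr_gt0 ?subr_ge0 ?subr_gt0.
  by rewrite /w; ring.
have v01' : 0 <= v <= 1 by rewrite !ltW.
have [H1 _] := entropyI_tangent u01 w01.
have [H2 _] := entropyI_tangent v01' w01.
set D := ln w - ln (1 - w) in H1 H2 *.
have : D * ((1 - s) * (u - w) + s * (v - w)) = 0 by rewrite /w; ring.
move: (ler_wpM2l s1' H1) (ler_wpM2l (ltW s0) H2) => {H1 H2}.
by move: (entropyI w) => e; nra.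
Qed.

(** * Real analytic functions *)

(* [F n h] is the [n]-th Taylor remainder divided by [h ^+ n]: unfolding the
   recursion, [f (x + h) = \sum_(i < n) F i 0 * h ^+ i + h ^+ n * F n h]. *)
Definition analytic_at (R : realType) (f : R -> R) (x : R) : Prop :=
  exists (F : nat -> R -> R) (C K r : R),
    [/\ 0 < r, 0 <= K, forall h, `|h| <= r -> F 0 h = f (x + h),
      forall n h, `|h| <= r -> F n h = F n 0 + h * F n.+1 h
    & forall n h, `|h| <= r -> `|F n h| <= C * K ^+ n].

Lemma analytic_at_cst (R : realType) (c x : R) : analytic_at (fun=> c) x.
Proof.
exists (fun n _ => if n is 0 then c else 0), `|c|, 1, 1; split=> //.
- by move=> [|n] h _; rewrite mulr0 addr0.
- by move=> [|n] h _; rewrite expr1n mulr1// normr0.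
Qed.

Lemma analytic_atD (R : realType) (f g : R -> R) (x : R) :
  analytic_at f x -> analytic_at g x -> analytic_at (fun y => f y + g y) x.
Proof.
move=> [F [C [K [r [r0 K0 F0 FS FC]]]]] [G [D [L [s [s0 L0 G0 GS GD]]]]].
have le0 t : 0 < t -> `|0 : R| <= t by rewrite normr0 => /ltW.
have C0 : 0 <= C.
  by have := FC 0 0 (le0 _ r0); rewrite expr0 mulr1; apply: le_trans.
have D0 : 0 <= D.
  by have := GD 0 0 (le0 _ s0); rewrite expr0 mulr1; apply: le_trans.
exists (fun n h => F n h + G n h), (C + D), (Num.max K L), (Num.min r s); split.
- by rewrite lt_min r0.
- by rewrite le_max K0.
- by move=> h; rewrite le_min => /andP[hr hs]; rewrite F0// G0.
- move=> n h; rewrite le_min => /andP[hr hs].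
  by rewrite (FS n h hr) (GS n h hs); ring.
- move=> n h; rewrite le_min => /andP[hr hs].
  rewrite (le_trans (ler_normD _ _))// mulrDl lerD//.
    by apply: (le_trans (FC n h hr)); rewrite ler_wpM2l// lerXn2r ?nnegrE//
      le_max ?lexx ?K0.
  by apply: (le_trans (GD n h hs)); rewrite ler_wpM2l// lerXn2r ?nnegrE//
    le_max ?lexx ?K0 ?orbT.
Qed.

Lemma analytic_atM (R : realType) (f g : R -> R) (x : R) :
  analytic_at f x -> analytic_at g x -> analytic_at (fun y => f y * g y) x.
Proof.
move=> [F [C [K [r [r0 K0 F0 FS FC]]]]] [G [D [L [s [s0 L0 G0 GS GD]]]]].
have le0 t : 0 < t -> `|0 : R| <= t by rewrite normr0 => /ltW.
have C0 : 0 <= C.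
  by have := FC 0 0 (le0 _ r0); rewrite expr0 mulr1; apply: le_trans.
have D0 : 0 <= D.
  by have := GD 0 0 (le0 _ s0); rewrite expr0 mulr1; apply: le_trans.
set M := Num.max K L.
have M0 : 0 <= M by rewrite le_max K0.
have FM n h : `|h| <= r -> `|F n h| <= C * M ^+ n.
  by move=> /FC/le_trans; apply; rewrite ler_wpM2l// lerXn2r ?nnegrE// le_max
    ?lexx ?K0.
have GM n h : `|h| <= s -> `|G n h| <= D * M ^+ n.
  by move=> /GD/le_trans; apply; rewrite ler_wpM2l// lerXn2r ?nnegrE// le_max
    ?lexx ?orbT.
(* Expand [f] to order [n], then the factor [g] multiplying the [i]-th term to order [n - i], and
   collect what carries [h ^+ n]. Each of the [n.+1] terms is at most [C * D * M ^+ n], and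
   [n.+1 <= 2 ^ n] gives the growth rate [2 * M]. *)
exists (fun n h => \sum_(i < n) F i 0 * G (n - i)%N h + F n h * G 0 h),
  (C * D), (2 * M), (Num.min r s); split.
- by rewrite lt_min r0.
- by rewrite mulr_ge0.
- move=> h; rewrite le_min => /andP[hr hs].
  by rewrite big_ord0 add0r F0// G0.
- move=> n h; rewrite le_min => /andP[hr hs].
  rewrite big_ord_recr/= subSnn (FS n h hr).
  transitivity (\sum_(i < n) (F i 0 * G (n - i)%N 0 + h * (F i 0 * G (n.+1 -
    i)%N h))
     + F n 0 * G 0 h + h * (F n.+1 h * G 0 h)).
    rewrite -addrA; congr (_ + _); last by ring.
    apply: eq_bigr => i _; rewrite (GS (n - i)%N h hs) subSn 1?ltnW//; ring.
  by rewrite big_split/= -mulr_sumr (GS 0 h hs); ring.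
- move=> n h; rewrite le_min => /andP[hr hs].
  have H : `|\sum_(i < n) F i 0 * G (n - i)%N h + F n h * G 0 h| <=
      \sum_(i < n.+1) C * D * M ^+ n.
    rewrite big_ord_recr/=; apply: (le_trans (ler_normD _ _)); apply: lerD.
      apply: (le_trans (ler_norm_sum _ _ _)); apply: ler_sum => i _.
      rewrite -[in leRHS](subnKC (ltnW (ltn_ord i))) exprD mulrACA normrM.
      by apply: ler_pM => //; [exact/FM/le0|exact: GM].
    rewrite normrM (_ : C * D * M ^+ n = C * M ^+ n * (D * M ^+ 0)).
      by apply: ler_pM => //; [exact: FM|exact: GM].
    by rewrite expr0; ring.
  apply: (le_trans H); rewrite sumr_const card_ord exprMn mulrCA.
  rewrite -natrX -[leLHS]mulr_natl ler_wpM2r ?mulr_ge0 ?exprn_ge0//.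
  by rewrite ler_nat ltn_expl.
Qed.

Lemma analytic_atX (R : realType) (f : R -> R) (x : R) (n : nat) :
  analytic_at f x -> analytic_at (fun y => f y ^+ n) x.
Proof.
move=> fx; elim: n => [|n IH].
  by under eq_fun do rewrite expr0; exact: analytic_at_cst.
by under eq_fun do rewrite exprS; exact: analytic_atM.
Qed.

(** If all Taylor coefficients vanish, [f (x + h)] equals [h ^+ n * F n h] for every [n], which
    tends to 0 for small [h]. Otherwise the first nonzero coefficient dominates the remainder near
    [x]. *)
Lemma analytic_at_isolated_zero (R : realType) (f : R -> R) (x : R) :
  analytic_at f x ->
  (exists2 d, 0 < d & forall y, `|y - x| < d -> f y = 0) \/
  (exists2 d, 0 < d & forall y, y != x -> `|y - x| < d -> f y != 0).
Proof.
move=> [F [C [K [r [r0 K0 F0 FS FC]]]]].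
have fE n h : `|h| <= r -> (forall i, (i < n)%N -> F i 0 = 0) ->
    f (x + h) = h ^+ n * F n h.
  move=> hr; elim: n => [|n IH] Fi0; first by rewrite mul1r F0.
  rewrite IH; last by move=> i /ltnW /Fi0.
  by rewrite (FS n h hr) Fi0// add0r exprSr mulrA.
have le0 : `|0 : R| <= r by rewrite normr0 ltW.
have [a0|/existsNP[n0 /eqP an0]] := pselect (forall n, F n 0 = 0).
  (* This radius gives [K * |h| <= 1/2], hence [|f (x + h)| <= C / 2 ^ n], and so
     [n * |f (x + h)| <= C] for all [n]. The summand 1 covers [K = 0]. *)
  left; exists (Num.min r (2 * K + 1)^-1).
    by rewrite lt_min r0 invr_gt0 ltr_wpDl ?mulr_ge0.
  move=> y; rewrite lt_min => /andP[/ltW yr yK]; set h := y - x in yr yK.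
  have -> : y = x + h by rewrite /h subrKC.
  have Kh : K * `|h| <= 2^-1.
    have k1 : 0 < 2 * K + 1 by rewrite ltr_wpDl ?mulr_ge0.
    move: yK; rewrite -(ltr_pM2l k1) divff ?gt_eqF//.
    by have := normr_ge0 h; nra.
  have Cn n : n%:R * `|f (x + h)| <= C.
    rewrite (fE n h yr)// normrM normrX.
    have : `|h| ^+ n * `|F n h| <= C * (2 ^+ n)^-1.
      apply: (@le_trans _ _ (C * (K * `|h|) ^+ n)).
        by rewrite exprMn mulrA [leRHS]mulrC ler_wpM2l ?exprn_ge0// FC.
      rewrite ler_wpM2l//; last by rewrite -exprVn lerXn2r ?nnegrE ?mulr_ge0.
      by have := FC 0 0 le0; rewrite mulr1; apply: le_trans.
    move=> H; apply: (@le_trans _ _ (2 ^+ n * (C * (2 ^+ n)^-1))); last first.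
      by rewrite mulrC mulfVK// gt_eqF// exprn_gt0.
    apply: ler_pM => //.
    by rewrite -natrX ler_nat ltnW// ltn_expl.
  apply/eqP; rewrite -normr_le0 leNgt; apply/negP => f0.
  have := Cn (Num.truncn (C / `|f (x + h)|)).+1.
  rewrite -ler_pdivlMr// leNgt => /negP; apply.
  by rewrite truncnS_gt.
right.
have ex : exists n, F n 0 != 0 by exists n0.
pose n := ex_minn ex.
have [an ai0] : F n 0 != 0 /\ forall i, (i < n)%N -> F i 0 = 0.
  rewrite /n; case: ex_minnP => m am mP; split=> // i im.
  by apply/eqP; apply: contraTT im => /mP; rewrite -leqNgt.
set B := C * K ^+ n.+1.
have B0 : 0 <= B by apply: le_trans (FC n.+1 0 le0).
have a0 : 0 < `|F n 0| by rewrite normr_gt0.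
(* [B] bounds the remainder of order [n.+1]; on this radius [|h| * B < |F n 0|], so [F n h] cannot
   vanish. *)
exists (Num.min r (`|F n 0| / (B + 1))).
  by rewrite lt_min r0 divr_gt0// ltr_wpDl.
move=> y yx; rewrite lt_min => /andP[/ltW yr yB]; set h := y - x in yr yB.
have -> : y = x + h by rewrite /h subrKC.
have h0 : h != 0 by rewrite /h subr_eq0.
rewrite (fE n h yr)// mulf_neq0 ?expf_neq0// (FS n h yr).
apply/negP => /eqP /(canRL (addrK _)); rewrite sub0r => E.
move: yB; rewrite ltr_pdivlMr ?ltr_wpDl// E normrN normrM.
apply/negP; rewrite -leNgt ler_wpM2l//.
by apply: (le_trans (FC n.+1 h yr)); rewrite lerDl.
Qed.

(** If [f] had a nonzero value at [y], the endpoints up to which [f] vanishes would have a supremum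
    [b]. Zeros accumulate at [b] from the left, so the dichotomy at [b] makes [f] vanish beyond
    it. *)
Lemma analytic_zero_continuation (R : realType) (f : R -> R) (x0 d : R) :
  0 < d -> (forall x, x0 <= x -> analytic_at f x) ->
  (forall x, `|x - x0| < d -> f x = 0) -> forall x, x0 <= x -> f x = 0.
Proof.
move=> d0 fan f0 y x0y; apply: contrapT => fy.
pose S := [set b | x0 <= b /\ forall x, x0 <= x <= b -> f x = 0].
have Sx0 : S x0.
  split=> // x; rewrite -eq_le => /eqP <-; apply: f0.
  by rewrite subrr normr0.
have Sy : ubound S y.
  move=> b [_ fb]; rewrite leNgt; apply/negP => yb.
  by apply: fy; apply: fb; rewrite x0y ltW.
have supS : has_sup S by split; [exists x0|exists y].
set b := sup S.
have x0b : x0 <= b by apply: sup_upper_bound.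
have Sb x : x0 <= x -> x < b -> f x = 0.
  move=> x0x xb; have [e [_ fe] be] := sup_adherent (eqbRL (subr_gt0 _ _) xb)
    supS.
  by apply: fe; rewrite x0x ltW//; move: be; rewrite opprB addrC subrK.
have ext e : 0 < e -> (forall x, `|x - b| < e -> f x = 0) -> False.
  move=> e0 fe; suff /(sup_upper_bound supS) : S (b + e / 2).
    by rewrite -/b -subr_ge0; lra.
  split; first by lra.
  move=> x /andP[x0x xb]; have [/Sb|bx] := ltP x b; first exact.
  by apply: fe; rewrite ger0_norm ?subr_ge0//; lra.
have [[e e0 /(ext e e0)//]|[e e0 fe]] := analytic_at_isolated_zero (fan b x0b).
(* When [b] is [x0] there are no zeros known to its left, and the given neighbourhood of [x0] serves
   instead. *)
have [bE|x0b'] := eqVneq x0 b; first by apply: (ext d d0) => x; rewrite -bE;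
  exact: f0.
have x0ltb : x0 < b by rewrite lt_neqAle x0b'.
pose x := Num.max x0 (b - e / 2).
have xb : x < b by rewrite gt_max x0ltb; lra.
have /eqP[] : f x != 0.
  apply: fe; first by rewrite lt_eqF.
  rewrite distrC ger0_norm ?subr_ge0 1?ltW//.
  have : b - e / 2 <= x by rewrite le_max lexx orbT.
  lra.
by apply: Sb => //; rewrite le_max lexx.
Qed.

(** Infinitely many zeros in a compact interval have a limit point, which is at least [m] and so
    lies in the domain of analyticity. There [f] vanishes locally, hence on the whole ray to the
    right, against the nonzero values found arbitrarily far out. *)
Lemma analytic_zeros_finite (R : realType) (f : R -> R) (m M : R) : 0 < m ->
  (forall x, 0 < x -> analytic_at f x) -> (forall x, exists2 y, x <= y & f y !=
    0) ->
  finite_set [set x | m <= x <= M /\ f x = 0].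
Proof.
move=> m0 fan fnz; apply: contrapT => Zinf.
have [|x Zx] := infinite_bounded_limit_point_nonempty Zinf.
  apply: sub_boundedr (compact_bounded (@segment_compact R m M)).
  by move=> P HP x [xmM _]; apply: HP.
have x0 : 0 < x.
  apply: (lt_le_trans m0); rewrite leNgt; apply/negP => xm.
  have [y [_ [/andP[my _] _]]] := Zx _ (nbhsx_ballx x (m - x) (eqbRL (subr_gt0
    _ _) xm)).
  rewrite /ball/= ltr_distlC => /andP[_]; lra.
have [[d d0 fd]|[d d0 fd]] := analytic_at_isolated_zero (fan x x0).
  have [y xy /eqP[]] := fnz x.
  apply: (analytic_zero_continuation d0 _ fd xy) => z xz.
  by apply: fan; apply: lt_le_trans xz.
have [y [yx [_ fy0] xy]] := Zx _ (nbhsx_ballx x d d0).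
have := fd y yx; rewrite distrC => /(_ xy); by rewrite fy0 eqxx.
Qed.

(** * Analyticity of the logarithm *)

(** The derivative of the Taylor polynomial is a finite geometric sum of ratio [- x / z];
    subtracting it from [(z + x)^-1] leaves the tail. *)
Lemma is_derive_ln_taylor (R : realType) (z x : R) (n : nat) : 0 < z -> 0 < z +
  x ->
  is_derive x (1 : R)
    (fun h => ln (z + h) -
       (ln z + \sum_(i < n) (- 1) ^+ i * h ^+ i.+1 / (i.+1%:R * z ^+ i.+1)))
    ((- x / z) ^+ n / (z + x)).
Proof.
move=> z0 zx0; elim: n => [|n IH].
  rewrite (_ : (fun h => _) = (@ln R \o (cst z + id)) - cst (ln z)); last first.
    by apply/funext => h; rewrite big_ord0 addr0.
  have D : is_derive ((cst z + id) x : R) (1 : R) (@ln R) (z + x)^-1 by exact: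
    is_derive1_ln.
  have D1 : is_derive x (1 : R) (cst z + id) (0 + 1) by exact: is_deriveD.
  have D2 := is_derive1_comp D D1.
  by apply: is_derive_eq; rewrite add0r subr0 expr0 mulr1 mul1r.
pose a := (- 1) ^+ n / (n.+1%:R * z ^+ n.+1).
pose g := fun h : R => ln (z + h) -
   (ln z + \sum_(i < n) (- 1) ^+ i * h ^+ i.+1 / (i.+1%:R * z ^+ i.+1)).
rewrite (_ : (fun h => _) = g - a \*: (id ^+ n.+1)); last first.
  apply/funext => h; rewrite big_ord_recr/= /a /g.
  rewrite -[LHS]/(ln (z + h) - _) -[RHS]/(_ - (_ * (id ^+ n.+1) h)).
  by rewrite fctE; ring.
apply: is_derive_eq => /=.
rewrite /GRing.scale/= mulr1.
have -> : a * (n.+1%:R * x ^+ n) = (- x / z) ^+ n / z.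
  rewrite /a expr_div_n -[- x]mulN1r exprMn [z ^+ n.+1]exprS; field.
  by rewrite expf_neq0 ?gt_eqF.
by rewrite [in RHS]exprS; field; rewrite !gt_eqF.
Qed.

(** Mean value theorem between 0 and [h] for the remainder, which vanishes at 0. On this range
    [z + x] is at least [z / 2], whence the factor 2. *)
Lemma ln_taylor_bound (R : realType) (z h : R) (n : nat) : 0 < z -> `|h| <= z /
  2 ->
  `|ln (z + h) -
     (ln z + \sum_(i < n) (- 1) ^+ i * h ^+ i.+1 / (i.+1%:R * z ^+ i.+1))|
  <= 2 * (`|h| / z) ^+ n.+1.
Proof.
move=> z0 hz; set g := fun h => ln (z + h) -
     (ln z + \sum_(i < n) (- 1) ^+ i * h ^+ i.+1 / (i.+1%:R * z ^+ i.+1)).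
change (`|g h| <= 2 * (`|h| / z) ^+ n.+1).
have g0 : g 0 = 0.
  rewrite /g big1; first by rewrite !addr0 subrr.
  by move=> i _; rewrite exprS mul0r mulr0 mul0r.
have pos x : `|x| <= z / 2 -> 0 < z / 2 /\ z / 2 <= z + x.
  by move=> /ler_normlP[xz1 xz2]; split; lra.
have Dg x : `|x| <= z / 2 -> is_derive x (1 : R) g ((- x / z) ^+ n / (z + x)).
  by move=> /pos [z2 zx]; apply: is_derive_ln_taylor => //;
    apply: lt_le_trans zx.
have cg x : `|x| <= z / 2 -> {for x, continuous g}.
  by move=> /Dg [Dx _]; apply/differentiable_continuous/derivable1_diffP.
have dgb x : `|x| <= `|h| -> `|(- x / z) ^+ n / (z + x)| <= 2 / z * (`|h| / z)
  ^+ n.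
  move=> xh; have [z2 zx] := pos x (le_trans xh hz).
  have zx0 := lt_le_trans z2 zx.
  rewrite normrM normrX normrM normrN !normfV (gtr0_norm z0) (gtr0_norm zx0)
    mulrC.
  apply: ler_pM.
  - by rewrite invr_ge0 ltW.
  - by rewrite exprn_ge0// divr_ge0// ltW.
  - by rewrite -[2 / z]invf_div lef_pV2 ?posrE.
  - by rewrite lerXn2r ?nnegrE ?divr_ge0 ?(ltW z0)// ler_wpM2r// invr_ge0 ltW.
have -> : 2 * (`|h| / z) ^+ n.+1 = 2 / z * (`|h| / z) ^+ n * `|h|.
  by rewrite exprS; ring.
have [h0|h0] := leP 0 h.
  have [x||x] := @MVT_segment R g (fun x => (- x / z) ^+ n / (z + x)) 0 h h0.
  - rewrite in_itv/= => /andP[x0 xh]; apply: Dg; apply: le_trans hz.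
    by rewrite !ger0_norm// ltW.
  - apply: continuous_in_subspaceT => x; rewrite inE/= in_itv/= => /andP[x0 xh].
    by apply: cg; apply: le_trans hz; rewrite !ger0_norm.
  - rewrite in_itv/= => /andP[x0 xh]; rewrite g0 !subr0 => ->.
    by rewrite normrM ler_wpM2r// dgb// !ger0_norm.
have [x||x] := @MVT_segment R g (fun x => (- x / z) ^+ n / (z + x)) h 0 (ltW
  h0).
- rewrite in_itv/= => /andP[x0 xh]; apply: Dg; apply: le_trans hz.
  by rewrite !ltr0_norm// lerN2 ltW.
- apply: continuous_in_subspaceT => x; rewrite inE/= in_itv/= => /andP[x0 xh].
  by apply: cg; apply: le_trans hz; rewrite ler0_norm// ltr0_norm// lerN2.
- rewrite in_itv/= => /andP[x0 xh]; rewrite g0 !sub0r -[`|g h|]normrN => ->.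
  by rewrite normrM normrN ler_wpM2r// dgb// ler0_norm// ltr0_norm// lerN2.
Qed.

Lemma analytic_at_ln (R : realType) (z : R) : 0 < z -> analytic_at (@ln R) z.
Proof.
move=> z0.
pose a n : R := if n is n.+1 then (- 1) ^+ n / (n.+1%:R * z ^+ n.+1) else ln z.
pose S n h := ln (z + h) - \sum_(i < n) a i * h ^+ i.
have SS n h : S n.+1 h = S n h - a n * h ^+ n.
  by rewrite /S big_ord_recr/=; ring.
have Sb n h : `|h| <= z / 2 -> `|S n.+1 h| <= 2 * (`|h| / z) ^+ n.+1.
  move=> /(ln_taylor_bound n z0); rewrite /S big_ord_recl/= mulr1.
  by under [in X in _ -> X]eq_bigr => i _ do rewrite mulrAC.
have ab n : `|a n| <= (`|ln z| + 2) * z^-1 ^+ n.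
  case: n => [|n]; first by rewrite expr0 mulr1 lerDl.
  rewrite /a normrM normrX normrN normr1 expr1n mul1r normfV normrM normrX.
  rewrite (gtr0_norm z0) normr_nat invfM exprVn ler_wpM2r//.
    by rewrite invr_ge0 exprn_ge0// ltW.
  apply: (@le_trans _ _ 1); first by rewrite invf_le1// ler1n.
  by have := normr_ge0 (ln z); lra.
(* At [h = 0] the quotient is replaced by its limit, the coefficient [a n]. The constant
   [|ln z| + 2] also covers order 0, where the remainder is [ln (z + h)] itself. *)
exists (fun n h => if h == 0 then a n else S n h / h ^+ n), (`|ln z| + 2),
  z^-1, (z / 2).
split=> //.
- by rewrite divr_gt0.
- by rewrite invr_ge0 ltW.
- move=> h _; case: eqP => [->|_]; first by rewrite addr0.
  by rewrite /S big_ord0 subr0 divr1.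
- move=> n h hz; rewrite eqxx; have [->|h0] := eqVneq h 0;
  first by rewrite mul0r addr0.
  rewrite SS exprS; field; rewrite h0/= expf_neq0//.
- move=> n h hz; case: eqP => [_|/eqP h0]; first exact: ab.
  case: n => [|n]; last first.
    rewrite normrM normfV normrX ler_pdivrMr ?exprn_gt0 ?normr_gt0//.
    apply: (le_trans (Sb n h hz)); rewrite -mulrA -exprMn [z^-1 * _]mulrC.
    by rewrite ler_wpM2r ?exprn_ge0 ?divr_ge0 ?(ltW z0)// lerDr.
  rewrite !expr0 mulr1 divr1 /S big_ord0 subr0.
  have := Sb 0 h hz; rewrite /S big_ord1 expr0 mulr1 expr1 => H.
  rewrite -[ln (z + h)](subrK (ln z)) (le_trans (ler_normD _ _))// addrC lerD2l.
  apply: (le_trans H); rewrite ler_piMr// ler_pdivrMr// mul1r.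
  by apply: (le_trans hz); lra.
Qed.

(** * Bounded measurable functions and the unit square *)

(** A class stable under the algebraic operations and under integration of sections, and contained
    in the integrable functions on sets of finite measure; every integrability condition below
    reduces to it. *)
Definition bounded_mfun (d : measure_display) (T : measurableType d)
    (R : realType) (D : set T) (f : T -> R) : Prop :=
  measurable_fun D f /\ exists M : R, forall z, D z -> `|f z| <= M.

Section bounded_mfun.
Context (d : measure_display) (T : measurableType d) (R : realType).
Implicit Types (D : set T) (f g : T -> R).

Lemma bounded_mfun_cst D (c : R) : bounded_mfun D (fun=> c).
Proof. by split; [exact: measurable_cst|exists `|c|]. Qed.

Lemma bounded_mfunD D f g : bounded_mfun D f -> bounded_mfun D g ->
  bounded_mfun D (fun z => f z + g z).
Proof.
move=> [mf [M fM]] [mg [N gN]]; split; first exact: measurable_funD.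
by exists (M + N) => z Dz; rewrite (le_trans (ler_normD _ _))// lerD// ?fM ?gN.
Qed.

Lemma bounded_mfunM D f g : bounded_mfun D f -> bounded_mfun D g ->
  bounded_mfun D (fun z => f z * g z).
Proof.
move=> [mf [M fM]] [mg [N gN]]; split; first exact: measurable_funM.
by exists (M * N) => z Dz; rewrite normrM ler_pM ?fM ?gN.
Qed.

Lemma bounded_mfunB D f g : bounded_mfun D f -> bounded_mfun D g ->
  bounded_mfun D (fun z => f z - g z).
Proof.
move=> [mf [M fM]] [mg [N gN]]; split; first exact: measurable_funB.
by exists (M + N) => z Dz; rewrite (le_trans (ler_normB _ _))// lerD// ?fM ?gN.
Qed.

Lemma bounded_mfunX D f (n : nat) : bounded_mfun D f ->
  bounded_mfun D (fun z => f z ^+ n).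
Proof.
move=> [mf [M fM]]; split; first exact: measurable_funX.
by exists (M ^+ n) => z Dz; rewrite normrX lerXn2r ?nnegrE// ?fM// (le_trans _
  (fM z Dz)).
Qed.

Lemma bounded_mfun_norm D f : bounded_mfun D f -> bounded_mfun D (fun z => `|f
  z|).
Proof.
move=> [mf [M fM]]; split; first exact: measurableT_comp.
by exists M => z Dz; rewrite normr_id fM.
Qed.

Lemma bounded_mfun_restrict D f : measurable D -> bounded_mfun D f ->
  bounded_mfun setT (f \_ D).
Proof.
move=> mD [mf [M fM]]; split; first by apply/(measurable_restrictT f mD).
exists `|M| => z _; rewrite patchE; case: ifPn => [/set_mem Dz|_].
  by rewrite (le_trans (fM z Dz))// ler_norm.
by rewrite normr0.
Qed.

Lemma bounded_mfun_integrable (mu : {measure set T -> \bar R}) D f :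
  measurable D -> (mu D < +oo)%E -> bounded_mfun D f ->
  mu.-integrable D (EFin \o f).
Proof.
move=> mD muD [mf [M fM]]; apply: measurable_bounded_integrable => //.
by exists M; split; [exact: num_real|move=> x Mx z Dz;
  rewrite /= (le_trans (fM z Dz))// ltW].
Qed.

Lemma Rintegral_bounded (mu : {measure set T -> \bar R}) D f (M : R) :
  measurable D -> mu D = 1%E -> measurable_fun D f -> (forall z, D z -> `|f z|
    <= M) ->
  `|\int[mu]_(z in D) f z| <= M.
Proof.
move=> mD muD mf fM.
have D1 : (mu D < +oo)%E by rewrite muD ltry.
have bf : bounded_mfun D f by split=> //; exists M.
apply: (le_trans (le_normr_Rintegral _ _)) => //;
  first exact: bounded_mfun_integrable.
apply: (@le_trans _ _ (\int[mu]_(z in D) M)).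
  apply: le_Rintegral => //.
  - by apply: bounded_mfun_integrable => //; exact: bounded_mfun_norm.
  - by apply: bounded_mfun_integrable => //; exact: bounded_mfun_cst.
by rewrite Rintegral_cst// muD mulr1.
Qed.

Lemma Rintegral_eq0_ae (mu : {measure set T -> \bar R}) D f :
  measurable D -> (mu D < +oo)%E -> bounded_mfun D f -> (forall z, D z -> 0 <=
    f z) ->
  \int[mu]_(z in D) f z = 0 -> {ae mu, forall z, D z -> f z = 0}.
Proof.
move=> mD muD bf f0 If0.
have fi := bounded_mfun_integrable mD muD bf.
have : (\int[mu]_(z in D) `|(EFin \o f) z|)%E = 0%E.
  rewrite (eq_integral (EFin \o f)); last first.
    by move=> z /set_mem Dz; rewrite /= ger0_norm// f0.
  rewrite -[LHS]fineK; last exact: integrable_fin_num.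
  by rewrite -/(Rintegral mu D f) If0.
move/(ae_eq_integral_abs mu mD (measurable_int mu fi)).
by apply: filterS => z /= + Dz => /(_ Dz) [].
Qed.

End bounded_mfun.

Section unit_square.
Variable R : realType.
Local Notation U := (unit_interval R).
Local Notation Q := (unit_square R).
Local Notation mu := (@lebesgue_measure R).
Local Notation mu2 := (lebesgue2 R).

Lemma measurable_unit_interval : measurable U.
Proof. exact: measurable_itv. Qed.

Lemma measurable_unit_square : measurable Q.
Proof. by apply: measurableX; exact: measurable_unit_interval. Qed.

Lemma lebesgue_unit_interval : mu U = 1%E.
Proof.
by rewrite /unit_interval lebesgue_measure_itv/= lte_fin ltr01 oppr0 adde0.
Qed.

Lemma lebesgue2_unit_square : mu2 Q = 1%E.
Proof.
rewrite /lebesgue2 product_measure1E; [|exact: measurable_unit_interval..].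
by rewrite -[RHS]mule1; congr (_ * _)%E; exact: lebesgue_unit_interval.
Qed.

Lemma lebesgue_unit_interval_lty : (mu U < +oo)%E.
Proof. by rewrite lebesgue_unit_interval ltry. Qed.

Lemma lebesgue2_unit_square_lty : (mu2 Q < +oo)%E.
Proof. by rewrite lebesgue2_unit_square ltry. Qed.

Lemma bounded_mfun_section (f : R * R -> R) (x : R) : bounded_mfun Q f -> U x ->
  bounded_mfun U (fun y => f (x, y)).
Proof.
move=> bf Ux; have [mfT _] := bounded_mfun_restrict measurable_unit_square bf.
case: bf => mf [M fM]; split; last by exists M => y Uy; apply: fM.
apply/(measurable_restrictT _ measurable_unit_interval).
rewrite (_ : _ \_ _ = fun y => (f \_ Q) (x, y));
  first exact: measurable_fun_pair2.
apply/funext => y; rewrite !patchE; congr (if _ then _ else _).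
by apply/idP/idP => /set_mem H; apply/mem_set; [split|case: H].
Qed.

Lemma restrict_unit_square (f : R * R -> R) (x y : R) :
  (f \_ Q) (x, y) = ((fun x => ((fun y => f (x, y)) \_ U) y) \_ U) x.
Proof.
rewrite !patchE; case: (boolP (x \in U)) => xU; last first.
  by rewrite ifF//; apply/negbTE; apply: contra xU => /set_mem[? _];
    exact/mem_set.
congr (if _ then _ else _).
by apply/idP/idP => /set_mem H; apply/mem_set; [case: H|split=> //;
  exact/set_mem].
Qed.

Lemma integrable_restrict_unit_square (f : R * R -> R) : bounded_mfun Q f ->
  (mu \x mu)%E.-integrable setT (EFin \o (f \_ Q)).
Proof.
move=> bf; rewrite -restrict_EFin.
apply/(integrable_mkcond _ measurable_unit_square).
apply: bounded_mfun_integrable => //; first exact: measurable_unit_square.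
exact: lebesgue2_unit_square_lty.
Qed.

(** Extension by zero off the square turns integration over sections of the plane into integration
    over [U]; measurability of section integrals and Fubini's theorem on the square follow from
    this. *)
Lemma fubini_F_unit_square (f : R * R -> R) : bounded_mfun Q f ->
  fubini_F mu (EFin \o (f \_ Q)) =
  EFin \o ((fun x => \int[mu]_(y in U) f (x, y)) \_ U).
Proof.
move=> bf; apply/funext => x; rewrite /fubini_F/= patchE; case: ifPn => xU.
  rewrite /Rintegral fineK; last first.
    apply: integrable_fin_num; first exact: measurable_unit_interval.
    apply: bounded_mfun_integrable; first exact: measurable_unit_interval.
      exact: lebesgue_unit_interval_lty.
    exact/bounded_mfun_section/set_mem.
  rewrite [RHS]integral_mkcond; apply: eq_integral => y _.
  by rewrite restrict_unit_square patchE xU restrict_EFin.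
by apply: integral0_eq => y _; rewrite restrict_unit_square patchE (negbTE xU).
Qed.

Lemma bounded_mfun_Rintegral (f : R * R -> R) : bounded_mfun Q f ->
  bounded_mfun U (fun x => \int[mu]_(y in U) f (x, y)).
Proof.
move=> bf; split.
  apply/(measurable_restrictT _ measurable_unit_interval)/measurable_EFinP.
  rewrite -fubini_F_unit_square//.
  exact: measurable_fubini_F (integrable_restrict_unit_square bf).
have [_ [M fM]] := bf; exists M => x Ux;
  have [mfx _] := bounded_mfun_section bf Ux.
apply: Rintegral_bounded => //; first exact: measurable_unit_interval.
  exact: lebesgue_unit_interval.
by move=> y Uy; apply: fM.
Qed.

Lemma Rintegral_unit_square (f : R * R -> R) : bounded_mfun Q f ->
  \int[mu2]_(z in Q) f z = \int[mu]_(x in U) \int[mu]_(y in U) f (x, y).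
Proof.
move=> bf; rewrite Rintegral_mkcond [RHS]Rintegral_mkcond /Rintegral.
rewrite -(integral12_prod_meas1 (integrable_restrict_unit_square bf)).
by rewrite fubini_F_unit_square.
Qed.

(** Both sides are iterated integrals of [f], taken in the same order of variables. *)
Lemma Rintegral_unit_square_swap (f : R * R -> R) : bounded_mfun Q f ->
  \int[mu2]_(z in Q) f (z.2, z.1) = \int[mu2]_(z in Q) f z.
Proof.
move=> bf.
have bs : bounded_mfun Q (fun z => f (z.2, z.1)).
  have [mf [M fM]] := bf; split; last by exists M => -[x y] [Ux Uy]; apply: fM.
  apply: (measurable_comp (F := Q) (g := fun z => (z.2, z.1))) mf _.
  - exact: measurable_unit_square.
  - by move=> _ [[x y] [Ux Uy] <-].
  - by apply: measurable_funTS; exact: measurable_swap.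
rewrite Rintegral_mkcond [RHS]Rintegral_mkcond /Rintegral.
rewrite -(integral12_prod_meas1 (integrable_restrict_unit_square bs)).
rewrite -(integral21_prod_meas1 (integrable_restrict_unit_square bf)).
congr fine; apply: eq_integral => x _; apply: eq_integral => y _ /=.
congr EFin; rewrite !patchE; congr (if _ then _ else _).
by apply/idP/idP => /set_mem[Ux Uy]; apply/mem_set.
Qed.

End unit_square.

Section bounded_Rintegral.
Context (d : measure_display) (T : measurableType d) (R : realType).
Variables (mu : {measure set T -> \bar R}) (D : set T).
Hypotheses (mD : measurable D) (muD : (mu D < +oo)%E).
Implicit Types f g : T -> R.

Lemma bounded_RintegralD f g : bounded_mfun D f -> bounded_mfun D g ->
  \int[mu]_(z in D) (f z + g z) = \int[mu]_(z in D) f z + \int[mu]_(z in D) g z.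
Proof. by move=> bf bg; rewrite RintegralD//;
  exact: bounded_mfun_integrable. Qed.

Lemma bounded_RintegralB f g : bounded_mfun D f -> bounded_mfun D g ->
  \int[mu]_(z in D) (f z - g z) = \int[mu]_(z in D) f z - \int[mu]_(z in D) g z.
Proof. by move=> bf bg; rewrite RintegralB//;
  exact: bounded_mfun_integrable. Qed.

Lemma bounded_RintegralZl f (c : R) : bounded_mfun D f ->
  \int[mu]_(z in D) (c * f z) = c * \int[mu]_(z in D) f z.
Proof. by move=> bf; rewrite RintegralZl//; exact: bounded_mfun_integrable. Qed.

Lemma bounded_le_Rintegral f g : bounded_mfun D f -> bounded_mfun D g ->
  (forall z, D z -> f z <= g z) -> \int[mu]_(z in D) f z <= \int[mu]_(z in D) g
    z.
Proof.
by move=> bf bg fg; apply: le_Rintegral => //; exact: bounded_mfun_integrable.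
Qed.

End bounded_Rintegral.

Lemma measurable_fun_inv (d : measure_display) (T : measurableType d)
    (R : realType) (D : set T) (f : T -> R) :
  measurable_fun D f -> (forall z, D z -> 0 < f z) ->
  measurable_fun D (fun z => (f z)^-1).
Proof.
move=> mf f0; apply: (eq_measurable_fun (fun z => expR (- ln (f z)))).
  by move=> z /set_mem Dz; rewrite expRN lnK// posrE f0.
apply: measurableT_comp; first exact: measurable_expR.
apply: measurableT_comp; first exact: oppr_measurable.
by apply: measurableT_comp mf; exact: measurable_ln.
Qed.

(** * Degree functions and convex combinations of graphons *)

Section degree.
Variable R : realType.
Local Notation U := (unit_interval R).
Local Notation Q := (unit_square R).
Local Notation mu := (@lebesgue_measure R).
Local Notation mu2 := (lebesgue2 R).
Implicit Types (h : R * R -> R) (f : R -> R).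

Definition degree h (x : R) : R := \int[mu]_(y in U) h (x, y).

Lemma graphon_bounded_mfun h : graphon h -> bounded_mfun Q h.
Proof.
move=> [mh h01 _]; split=> //; exists 1 => z Qz.
by have /andP[h0 h1] := h01 z Qz; rewrite ger0_norm.
Qed.

Lemma degree_bounded_mfun h : graphon h -> bounded_mfun U (degree h).
Proof. by move=> /graphon_bounded_mfun /bounded_mfun_Rintegral. Qed.

Lemma degree_itv h x : graphon h -> U x -> 0 <= degree h x <= 1.
Proof.
move=> gh Ux; have [_ h01 _] := gh.
have hxy y : U y -> 0 <= h (x, y) <= 1 by move=> Uy; apply: h01.
rewrite Rintegral_ge0/=; last by move=> y /hxy /andP[].
apply: le_trans (ler_norm _) _.
apply: Rintegral_bounded.
- exact: measurable_unit_interval.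
- exact: lebesgue_unit_interval.
- by have [] := bounded_mfun_section (graphon_bounded_mfun gh) Ux.
- by move=> y /hxy /andP[h0 h1]; rewrite ger0_norm.
Qed.

Lemma bounded_mfun_fst f : bounded_mfun U f -> bounded_mfun Q (fun z => f z.1).
Proof.
move=> [mf [M fM]]; split; last by exists M => z [Uz _]; apply: fM.
apply: (measurable_comp (F := U) (g := fst)) mf _.
- exact: measurable_unit_interval.
- by move=> _ [z [Ux Uy] <-].
- by apply: measurable_funTS; exact: measurable_fst.
Qed.

Lemma bounded_mfun_snd f : bounded_mfun U f -> bounded_mfun Q (fun z => f z.2).
Proof.
move=> [mf [M fM]]; split; last by exists M => z [_ Uz]; apply: fM.
apply: (measurable_comp (F := U) (g := snd)) mf _.
- exact: measurable_unit_interval.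
- by move=> _ [z [Ux Uy] <-].
- by apply: measurable_funTS; exact: measurable_snd.
Qed.

Lemma entropyI_bounded_mfun h : graphon h -> bounded_mfun Q (fun z => entropyI
  (h z)).
Proof.
move=> gh; have [mh h01 _] := gh; split; last first.
  by exists 2 => z /h01; exact: entropyI_bounded.
have m1h : measurable_fun Q (fun z => 1 - h z).
  by apply: measurable_funB => //; exact: measurable_cst.
apply: measurable_funD; apply: measurable_funM => //;
  by apply: measurableT_comp => //; exact: measurable_ln.
Qed.

Lemma Rintegral_fst_degree h f : graphon h -> bounded_mfun U f ->
  \int[mu2]_(z in Q) (f z.1 * h z) = \int[mu]_(x in U) (f x * degree h x).
Proof.
move=> gh bf; have bh := graphon_bounded_mfun gh.
rewrite Rintegral_unit_square; last by apply: bounded_mfunM => //;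
  exact: bounded_mfun_fst.
apply: eq_Rintegral => x /set_mem Ux /=.
rewrite bounded_RintegralZl//.
- exact: measurable_unit_interval.
- exact: lebesgue_unit_interval_lty.
- exact: bounded_mfun_section.
Qed.

(** Swapping coordinates and the symmetry of [h] reduce this to the first coordinate. With both
    versions, an integral against the degree becomes one against a symmetric weight on the
    square. *)
Lemma Rintegral_snd_degree h f : graphon h -> bounded_mfun U f ->
  \int[mu2]_(z in Q) (f z.2 * h z) = \int[mu]_(x in U) (f x * degree h x).
Proof.
move=> gh bf; have bh := graphon_bounded_mfun gh; have [_ _ hsym] := gh.
rewrite -Rintegral_fst_degree// -[LHS]Rintegral_unit_square_swap; last first.
  by apply: bounded_mfunM => //; exact: bounded_mfun_snd.
by apply: eq_Rintegral => -[x y] /set_mem Qxy /=; rewrite (hsym x y).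
Qed.

Lemma graphon_convex h g (s : R) : graphon h -> graphon g -> 0 <= s <= 1 ->
  graphon (fun z => (1 - s) * h z + s * g z).
Proof.
move=> gh gg /andP[s0 s1]; have [mh h01 hsym] := gh; have [mg g01 gsym] := gg.
have s1' : 0 <= 1 - s by rewrite subr_ge0.
split.
- by apply: measurable_funD; apply: measurable_funM => //;
  exact: measurable_cst.
- move=> z Qz; have /andP[h0 h1] := h01 z Qz; have /andP[g0 g1] := g01 z Qz.
  by apply/andP; split; nra.
- by move=> x y Qxy; rewrite hsym// gsym.
Qed.

Lemma edge_density_convex h g (s : R) : graphon h -> graphon g ->
  edge_density (fun z => (1 - s) * h z + s * g z) =
  (1 - s) * edge_density h + s * edge_density g.
Proof.
move=> /graphon_bounded_mfun bh /graphon_bounded_mfun bg; rewrite /edge_density.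
have mQ := @measurable_unit_square R; have fQ := @lebesgue2_unit_square_lty R.
rewrite bounded_RintegralD// ?bounded_RintegralZl//;
  by apply: bounded_mfunM => //; exact: bounded_mfun_cst.
Qed.

Lemma degree_convex h g (s x : R) : graphon h -> graphon g -> U x ->
  degree (fun z => (1 - s) * h z + s * g z) x = (1 - s) * degree h x + s *
    degree g x.
Proof.
move=> /graphon_bounded_mfun bh /graphon_bounded_mfun bg Ux; rewrite /degree.
have mU := @measurable_unit_interval R; have fU := @lebesgue_unit_interval_lty
  R.
have bhx := bounded_mfun_section bh Ux; have bgx := bounded_mfun_section bg Ux.
rewrite bounded_RintegralD// ?bounded_RintegralZl//;
  by apply: bounded_mfunM => //; exact: bounded_mfun_cst.
Qed.

End degree.

(** * The variational argument *)

Section variation.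
Variable R : realType.
Local Notation U := (unit_interval R).
Local Notation Q := (unit_square R).
Local Notation mu := (@lebesgue_measure R).
Local Notation mu2 := (lebesgue2 R).
Implicit Types (h g : R * R -> R).

Lemma optimizing_graphon_le (p : nat) (eps beta2 : R) h g :
  optimizing_graphon p eps beta2 h -> graphon g -> edge_density g = eps ->
  objective p beta2 g <= objective p beta2 h.
Proof.
by move=> [_ _ hpsi] gg ge; rewrite -lee_fin hpsi; apply: ereal_sup_ubound;
  exists g.
Qed.

Lemma entropy_convex_le h g (s : R) : graphon h -> graphon g ->
  (forall z, Q z -> 0 < g z < 1) -> 0 < s <= 1 ->
  \int[mu2]_(z in Q) entropyI ((1 - s) * h z + s * g z) <=
  (1 - s) * \int[mu2]_(z in Q) entropyI (h z) + s * \int[mu2]_(z in Q) entropyI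
    (g z).
Proof.
move=> gh gg g01 s01.
have mQ := @measurable_unit_square R; have fQ := @lebesgue2_unit_square_lty R.
have bIh := entropyI_bounded_mfun gh; have bIg := entropyI_bounded_mfun gg.
have s01' : 0 <= s <= 1 by case/andP: s01 => /ltW -> ->.
rewrite -!bounded_RintegralZl// -bounded_RintegralD//; first last.
- by apply: bounded_mfunM => //; exact: bounded_mfun_cst.
- by apply: bounded_mfunM => //; exact: bounded_mfun_cst.
have [_ h01 _] := gh.
apply: bounded_le_Rintegral => //.
- exact: (entropyI_bounded_mfun (graphon_convex gh gg s01')).
- by apply: bounded_mfunD; apply: bounded_mfunM => //; exact: bounded_mfun_cst.
- by move=> z Qz; apply: entropyI_convex => //; [exact: h01|exact: g01].
Qed.

(** The degree is affine in [s], so its increment at [x] is [s] times a number of absolute value at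
    most 1; [expr_taylor_bound] is then integrated over [x]. *)
Lemma star_density_convex_bound (n : nat) h g (s : R) :
  graphon h -> graphon g -> 0 <= s <= 1 ->
  `|star_density n.+1 (fun z => (1 - s) * h z + s * g z) - star_density n.+1 h
    - s * n.+1%:R * \int[mu]_(x in U) (degree h x ^+ n * (degree g x - degree h
      x))|
  <= n.+1%:R ^+ 2 * s ^+ 2.
Proof.
move=> gh gg s01.
have mU := @measurable_unit_interval R; have fU := @lebesgue_unit_interval_lty
  R.
have gs := graphon_convex gh gg s01.
have bh := degree_bounded_mfun gh; have bg := degree_bounded_mfun gg.
have bs := degree_bounded_mfun gs.
have bq : bounded_mfun U (fun x => degree h x ^+ n * (degree g x - degree h x)).
  by apply: bounded_mfunM; [exact: bounded_mfunX|exact: bounded_mfunB].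
rewrite /star_density -bounded_RintegralZl//.
rewrite -bounded_RintegralB//; [|exact: bounded_mfunX..].
rewrite -bounded_RintegralB//; first last.
- by apply: bounded_mfunM => //; exact: bounded_mfun_cst.
- by apply: bounded_mfunB; exact: bounded_mfunX.
apply: Rintegral_bounded => //.
- exact: lebesgue_unit_interval.
- suff [] : bounded_mfun U (fun x =>
    degree (fun z => (1 - s) * h z + s * g z) x ^+ n.+1 - degree h x ^+ n.+1
    - s * n.+1%:R * (degree h x ^+ n * (degree g x - degree h x))) by [].
  apply: bounded_mfunB; first by apply: bounded_mfunB; exact: bounded_mfunX.
  by apply: bounded_mfunM => //; exact: bounded_mfun_cst.
move=> x Ux; rewrite -!/(degree _ x).
rewrite -/(degree (fun z => (1 - s) * h z + s * g z) x).
have dh := degree_itv gh Ux; have dg := degree_itv gg Ux;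
  have ds := degree_itv gs Ux.
have := expr_taylor_bound n dh ds; rewrite degree_convex//.
set a := degree h x; set b := degree g x; set e := (1 - s) * a + s * b.
have -> : e - a = s * (b - a) by rewrite /e; ring.
have -> : n.+1%:R * a ^+ n * (s * (b - a)) = s * n.+1%:R * (a ^+ n * (b - a))
  by ring.
move=> /le_trans; apply; rewrite exprMn ler_wpM2l ?sqr_ge0// ler_piMr
  ?sqr_ge0//.
rewrite -[leRHS](expr1n _ 2) -real_normK ?num_real// lerXn2r ?nnegrE//.
by rewrite ler_norml; case/andP: dh; case/andP: dg; rewrite -/a -/b; lra.
Qed.

(** Optimality against [(1 - s) * h + s * g] gives [s * A <= C * s ^+ 2], with convexity bounding
    the entropy of the mixture; letting [s] be small forces [A <= 0]. *)
Lemma optimizing_graphon_first_order (n : nat) (eps beta2 : R) h g :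
  optimizing_graphon n.+1 eps beta2 h -> graphon g -> edge_density g = eps ->
  (forall z, Q z -> 0 < g z < 1) ->
  beta2 * n.+1%:R * \int[mu]_(x in U) (degree h x ^+ n * (degree g x - degree h
    x))
  <= 2^-1 * (\int[mu2]_(z in Q) entropyI (g z) - \int[mu2]_(z in Q) entropyI (h
    z)).
Proof.
move=> hopt gg ge g01; have [gh he _] := hopt.
set q := Rintegral _ _ _; set Ig := Rintegral _ _ _; set Ih := Rintegral _ _ _.
rewrite -subr_le0; set A := _ - _.
set C := `|beta2| * n.+1%:R ^+ 2.
have C0 : 0 <= C by rewrite mulr_ge0.
have As s : 0 < s <= 1 -> A <= C * s.
  move=> s01; have [s0 s1] := andP s01.
  have s01' : 0 <= s <= 1 by rewrite ltW.
  have : objective n.+1 beta2 (fun z => (1 - s) * h z + s * g z) <= objective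
    n.+1 beta2 h.
    apply: (optimizing_graphon_le hopt); first exact: graphon_convex.
    by rewrite edge_density_convex// he ge; ring.
  rewrite /objective -/Ih.
  have := star_density_convex_bound n gh gg s01'.
  have := entropy_convex_le gh gg g01 s01; rewrite -/Ih -/Ig -/q.
  set Is := Rintegral _ _ _; set ts := star_density _ _;
    set t := star_density _ _.
  move=> HI Ht Hobj.
  have : `|beta2 * (ts - t - s * n.+1%:R * q)| <= C * s ^+ 2.
    by rewrite normrM /C -[leRHS]mulrA ler_wpM2l.
  move=> /ler_normlP[H1 _].
  rewrite -(ler_pM2l s0) /A.
  by move: HI H1 Hobj; rewrite /C; nra.
rewrite leNgt; apply/negP => A0.
(* For positive [A], the value [s = A / (A + C + 1)] is admissible and contradicts [A <= C * s],
   which would read [A * (A + 1) <= 0]. *)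
have C1 : 0 < A + C + 1 by lra.
have /As : 0 < A / (A + C + 1) <= 1 by rewrite divr_gt0//= ler_pdivrMr//; lra.
by rewrite mulrA ler_pdivlMr//; nra.
Qed.

(** The last hypothesis is the Euler-Lagrange equation, at [g], of the problem linearized at [h],
    with [lambda] the multiplier of the density constraint. *)
Lemma optimizing_graphon_unique (n : nat) (eps beta2 lambda : R) h g :
  optimizing_graphon n.+1 eps beta2 h -> graphon g -> edge_density g = eps ->
  (forall z, Q z -> 0 < g z < 1) ->
  (forall z, Q z -> ln (g z) - ln (1 - g z) =
     lambda + beta2 * n.+1%:R * (degree h z.1 ^+ n + degree h z.2 ^+ n)) ->
  {ae mu2, forall z, Q z -> h z = g z}.
Proof.
move=> hopt gg ge g01 gE; have [gh he _] := hopt.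
have mQ := @measurable_unit_square R; have fQ := @lebesgue2_unit_square_lty R.
have mU := @measurable_unit_interval R; have fU := @lebesgue_unit_interval_lty
  R.
have bIh := entropyI_bounded_mfun gh; have bIg := entropyI_bounded_mfun gg.
have bh := graphon_bounded_mfun gh; have bg := graphon_bounded_mfun gg.
have bdh := degree_bounded_mfun gh; have bdg := degree_bounded_mfun gg.
have bdn : bounded_mfun U (fun x => degree h x ^+ n) by exact: bounded_mfunX.
have bd1 := bounded_mfun_fst bdn; have bd2 := bounded_mfun_snd bdn.
set c := beta2 * n.+1%:R.
(* On the square this is the slope of the entropy at [g z], multiplied by [f z]. By symmetry the two
   degree terms have equal integrals; the resulting 2 matches the factor 1/2 before the entropy in
   the objective. *)
pose lin f z := lambda * f z + c * (degree h z.1 ^+ n * f z + degree h z.2 ^+ n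
  * f z).
have blin f : bounded_mfun Q f -> bounded_mfun Q (lin f).
  move=> bf; apply: bounded_mfunD; first by apply: bounded_mfunM => //;
    exact: bounded_mfun_cst.
  by apply: bounded_mfunM; [exact: bounded_mfun_cst|apply: bounded_mfunD;
    exact: bounded_mfunM].
have Ilin f : graphon f -> edge_density f = eps -> \int[mu2]_(z in Q) lin f z =
    lambda * eps + c * (2 * \int[mu]_(x in U) (degree h x ^+ n * degree f x)).
  move=> gf fe; have bf := graphon_bounded_mfun gf.
  have b1 := bounded_mfunM bd1 bf; have b2 := bounded_mfunM bd2 bf.
  rewrite /lin bounded_RintegralD//; first last.
  - by apply: bounded_mfunM; [exact: bounded_mfun_cst|exact: bounded_mfunD].
  - by apply: bounded_mfunM => //; exact: bounded_mfun_cst.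
  rewrite !bounded_RintegralZl//; last exact: bounded_mfunD.
  rewrite bounded_RintegralD// -/(edge_density f) fe.
  rewrite (Rintegral_fst_degree (f := fun x => degree h x ^+ n))//.
  by rewrite (Rintegral_snd_degree (f := fun x => degree h x ^+ n))//; ring.
(* The Bregman divergence of the entropy between [h z] and [g z]: nonnegative, and zero only where
   they agree. The first-order inequality makes its integral at most 0. *)
pose gap z := (entropyI (h z) - entropyI (g z)) - (lin h z - lin g z).
have bgap : bounded_mfun Q gap by apply: bounded_mfunB;
  apply: bounded_mfunB => //; exact: blin.
have gap_leif z : Q z -> 0 <= gap z ?= iff (h z == g z).
  move=> Qz; have [_ h01 _] := gh; have := entropyI_tangent (h01 z Qz) (g01 z
    Qz).
  rewrite (gE z Qz) -/c => -[H1 H2]; split.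
    by move: H1; rewrite /gap /lin; lra.
  by rewrite -H2 /gap /lin eq_sym -subr_eq0 -[RHS]eq_sym -[RHS]subr_eq0;
    congr (_ == _); ring.
have Igap : \int[mu2]_(z in Q) gap z = 0.
  apply/eqP; rewrite eq_le Rintegral_ge0 ?andbT; last by move=> z /gap_leif[].
  rewrite /gap bounded_RintegralB//; [|exact: bounded_mfunB|by apply:
    bounded_mfunB; exact: blin].
  rewrite !bounded_RintegralB//; [|exact: blin..].
  rewrite !Ilin//.
  have := optimizing_graphon_first_order hopt gg ge g01.
  under eq_Rintegral do rewrite mulrBr.
  by rewrite bounded_RintegralB// -/c; [lra|exact: bounded_mfunM..].
have := Rintegral_eq0_ae mQ fQ bgap (fun z Qz => (gap_leif z Qz).1) Igap.
apply: filterS => z H Qz; apply/eqP; rewrite -(gap_leif z Qz).2 eq_sym.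
exact/eqP/H.
Qed.

End variation.

(** * Logistic integrals: prescribed density and analyticity *)

Lemma bounded_mfun_inv1D (d : measure_display) (T : measurableType d)
    (R : realType) (D : set T) (f : T -> R) :
  bounded_mfun D f -> (forall z, D z -> 0 <= f z) ->
  bounded_mfun D (fun z => (1 + f z)^-1).
Proof.
move=> [mf _] f0; split.
  apply: measurable_fun_inv; last by move=> z /f0;
    rewrite -(lerDl 1) => /(lt_le_trans _)->.
  by apply: measurable_funD => //; exact: measurable_cst.
exists 1 => z /f0 fz0; have f1 : 1 <= 1 + f z by rewrite lerDl.
by rewrite ger0_norm ?invf_le1 ?invr_ge0 ?(lt_le_trans _ f1)// (le_trans _ f1).
Qed.

Lemma Rintegral_cst1 (d : measure_display) (T : measurableType d) (R : realType)
    (mu : {measure set T -> \bar R}) (D : set T) (c : R) :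
  measurable D -> mu D = 1%E -> \int[mu]_(z in D) c = c.
Proof. by move=> mD muD; rewrite Rintegral_cst// muD mulr1. Qed.

Section logistic.
Variable R : realType.
Local Notation U := (unit_interval R).
Local Notation Q := (unit_square R).
Local Notation mu := (@lebesgue_measure R).
Local Notation mu2 := (lebesgue2 R).

Lemma exists_logistic_density (v : R * R -> R) (m M eps : R) :
  bounded_mfun Q v -> 0 < m -> (forall z, Q z -> m <= v z <= M) -> 0 < eps < 1
    ->
  exists2 K, 0 < K & \int[mu2]_(z in Q) (1 + K * v z)^-1 = eps.
Proof.
move=> bv m0 vmM /andP[e0 e1].
have mQ := @measurable_unit_square R; have fQ := @lebesgue2_unit_square_lty R.
have v0 z : Q z -> 0 < v z by move=> /vmM/andP[/(lt_le_trans m0)].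
have mM : m <= M.
  have /andP[] : m <= v (0, 0) <= M.
    by apply: vmM; split; rewrite /= /unit_interval/= in_itv/= lexx ler01.
  exact: le_trans.
have M0 : 0 < M := lt_le_trans m0 mM.
(* The constant value [b] of [K * v] would give density exactly [eps]. With [K = b / M] the product
   stays below [b], with [K = b / m] above it, and the intermediate value theorem applies in
   between. *)
pose b := eps^-1 - 1.
have b0 : 0 < b by rewrite subr_gt0 invf_gt1.
have epsE : (1 + b)^-1 = eps by rewrite /b subrKC invrK.
(* The absolute value keeps the denominators at least 1 for every real [K], so [F] is Lipschitz on
   the whole line. *)
pose F (K : R) := \int[mu2]_(z in Q) (1 + `|K| * v z)^-1.
have bF (K : R) : bounded_mfun Q (fun z => (1 + `|K| * v z)^-1).
  apply: bounded_mfun_inv1D; last by move=> z /v0 /ltW vz; rewrite mulr_ge0.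
  by apply: bounded_mfunM => //; exact: bounded_mfun_cst.
have Flip (K L : R) : `|F K - F L| <= M * `|K - L|.
  rewrite /F -bounded_RintegralB//; apply: Rintegral_bounded => //.
  - exact: lebesgue2_unit_square.
  - by have [] := bounded_mfunB (bF K) (bF L).
  move=> z Qz; have vz0 := v0 z Qz; have /andP[_ vM] := vmM z Qz.
  have K1 : 1 <= 1 + `|K| * v z by rewrite lerDl mulr_ge0// ltW.
  have L1 : 1 <= 1 + `|L| * v z by rewrite lerDl mulr_ge0// ltW.
  have -> : (1 + `|K| * v z)^-1 - (1 + `|L| * v z)^-1 =
      (`|L| - `|K|) * v z * ((1 + `|K| * v z)^-1 * (1 + `|L| * v z)^-1).
    by field; rewrite !gt_eqF// (lt_le_trans ltr01).
  rewrite 2!normrM (gtr0_norm vz0) [`|K - L|]distrC -[leRHS]mulr1.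
  apply: ler_pM => //; first by rewrite mulr_ge0// ltW.
    by rewrite mulrC; apply: ler_pM => //; [exact: ltW|exact: ler_dist_dist].
  rewrite normrM -[leRHS]mulr1.
  by apply: ler_pM => //; rewrite ger0_norm ?invr_ge0 ?invf_le1 ?(lt_le_trans
    ltr01)// (le_trans ler01).
have cF : continuous F.
  move=> K; apply/cvgrPdist_le => /= e ep.
  have eM : 0 < e / M by rewrite divr_gt0.
  apply: filterS (nbhsx_ballx K _ eM) => L /ltW KL.
  by apply: (le_trans (Flip K L)); rewrite mulrC -ler_pdivlMr.
have Fc K c : 0 < K -> (forall z, Q z -> K * v z <= c) -> (1 + c)^-1 <= F K.
  move=> K0 Kc; have <- : \int[mu2]_(z in Q) (1 + c)^-1 = (1 + c)^-1.
    by apply: Rintegral_cst1 => //; exact: lebesgue2_unit_square.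
  apply: bounded_le_Rintegral => //; first exact: bounded_mfun_cst.
  move=> z Qz; have p := mulr_gt0 K0 (v0 z Qz).
  rewrite gtr0_norm// lef_pV2 ?lerD2l ?Kc// posrE; first by have := Kc z Qz;
    lra.
  lra.
have Fc' K c : 0 < K -> 0 < c -> (forall z, Q z -> c <= K * v z) -> F K <= (1 +
  c)^-1.
  move=> K0 c0 Kc; have <- : \int[mu2]_(z in Q) (1 + c)^-1 = (1 + c)^-1.
    by apply: Rintegral_cst1 => //; exact: lebesgue2_unit_square.
  apply: bounded_le_Rintegral => //; first exact: bounded_mfun_cst.
  move=> z Qz; rewrite gtr0_norm// lef_pV2 ?lerD2l ?Kc// posrE; last by lra.
  by have := Kc z Qz; lra.
have F1 : eps <= F (b / M).
  rewrite -epsE; apply: Fc => [|z /vmM/andP[_ vM]]; first by rewrite divr_gt0.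
  by rewrite mulrAC ler_pdivrMr// ler_pM2l.
have F2 : F (b / m) <= eps.
  rewrite -epsE; apply: Fc' => [||z /vmM/andP[vm _]] //;
    first by rewrite divr_gt0.
  by rewrite mulrAC ler_pdivlMr// ler_pM2l.
have bMm : b / M <= b / m by rewrite ler_pM2l// lef_pV2.
have Feps : Num.min (F (b / M)) (F (b / m)) <= eps <= Num.max (F (b / M)) (F (b
  / m)).
  by rewrite ge_min F2 orbT le_max F1.
have [K] := IVT bMm (continuous_subspaceT cF) Feps.
rewrite in_itv/= => /andP[bK _] FK.
have K0 : 0 < K by apply: lt_le_trans bK; rewrite divr_gt0.
by exists K => //; rewrite -FK /F gtr0_norm.
Qed.

(** With [th y = k y / (1 + k y * x)], the [n]-th remainder of the integrand is
    [(- th y) ^+ n / (1 + k y * (x + h))]. Since [th y <= x^-1] uniformly in [y], integrating keeps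
    the geometric bounds. *)
Lemma analytic_at_logistic_Rintegral (k : R -> R) (x : R) : 0 < x ->
  bounded_mfun U k -> (forall y, U y -> 0 < k y) ->
  analytic_at (fun t => \int[mu]_(y in U) (1 + k y * t)^-1) x.
Proof.
move=> x0 bk k0.
have mU := @measurable_unit_interval R; have fU := @lebesgue_unit_interval_lty
  R.
pose th y := k y * (1 + k y * x)^-1.
have bkt t : 0 < t -> bounded_mfun U (fun y => (1 + k y * t)^-1).
  move=> t0; apply: bounded_mfun_inv1D.
    by apply: bounded_mfunM => //; exact: bounded_mfun_cst.
  by move=> y /k0 ky; rewrite mulr_ge0// ltW.
have bth n : bounded_mfun U (fun y => (- th y) ^+ n).
  apply: bounded_mfunX; under eq_fun do rewrite -mulN1r.
  apply: bounded_mfunM; first exact: bounded_mfun_cst.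
  by apply: bounded_mfunM => //; exact: bkt.
have xh h : `|h| <= x / 2 -> 0 < x + h by move=> /ler_normlP[? ?]; lra.
pose f n h y := (- th y) ^+ n * (1 + k y * (x + h))^-1.
have bf n h : `|h| <= x / 2 -> bounded_mfun U (f n h).
  by move=> hx; apply: bounded_mfunM => //; apply: bkt; exact: xh.
have hx0 : `|0 : R| <= x / 2 by rewrite normr0 divr_ge0// ltW.
exists (fun n h => \int[mu]_(y in U) f n h y), 1, x^-1, (x / 2); split.
- by rewrite divr_gt0.
- by rewrite invr_ge0 ltW.
- by move=> h hx; apply: eq_Rintegral => y _; rewrite /f expr0 mul1r.
- move=> n h hx; rewrite -bounded_RintegralZl//; last exact: bf.
  rewrite -bounded_RintegralD//; [|exact: bf|]; last first.
    by apply: bounded_mfunM; [exact: bounded_mfun_cst|exact: bf].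
  apply: eq_Rintegral => y /set_mem Uy; rewrite /f /th addr0 exprS.
  set q := _ ^+ n.
  have p1 : 0 < 1 + k y * x by rewrite addr_gt0// mulr_gt0// k0.
  have p2 : 0 < 1 + k y * (x + h) by rewrite addr_gt0// mulr_gt0 ?k0 ?xh.
  by field; rewrite !gt_eqF.
- move=> n h hx; rewrite mul1r; apply: Rintegral_bounded => //.
  + exact: lebesgue_unit_interval.
  + by have [] := bf n h hx.
  move=> y Uy; have ky := k0 y Uy.
  have p1 : 0 < 1 + k y * x by rewrite addr_gt0// mulr_gt0.
  have p2 : 1 <= 1 + k y * (x + h) by rewrite lerDl mulr_ge0 ?ltW// xh.
  rewrite /f normrM normrX normrN -[leRHS]mulr1.
  apply: ler_pM => //; last by rewrite ger0_norm ?invr_ge0 ?invf_le1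
    ?(lt_le_trans ltr01)// (le_trans ler01).
  have th0 : 0 <= th y by rewrite mulr_ge0 ?invr_ge0// ltW.
  rewrite lerXn2r ?nnegrE ?invr_ge0 ?(ltW x0)// ger0_norm//.
  rewrite /th ler_pdivrMr// mulrDr mulr1 mulrCA mulVf ?gt_eqF// mulr1.
  by rewrite lerDr invr_ge0 ltW.
Qed.

End logistic.

(** * Almost everywhere equality and multipodality *)

Section multipodal.
Variable R : realType.
Local Notation U := (unit_interval R).
Local Notation Q := (unit_square R).
Local Notation mu := (@lebesgue_measure R).
Local Notation mu2 := (lebesgue2 R).

Lemma lebesgue2_ae_fst (P : R -> Prop) :
  {ae mu, forall x, P x} -> {ae mu2, forall z, P z.1}.
Proof.
move=> [N [mN N0 PN]]; exists (N `*` setT); split.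
- exact: measurableX.
- rewrite /lebesgue2 product_measure1E//.
  by rewrite -[RHS](mul0e (mu setT)); congr (_ * _)%E.
- by move=> z Pz; split=> //; apply: PN.
Qed.

Lemma lebesgue2_ae_snd (P : R -> Prop) :
  {ae mu, forall x, P x} -> {ae mu2, forall z, P z.2}.
Proof.
move=> [N [mN N0 PN]]; exists (setT `*` N); split.
- exact: measurableX.
- rewrite /lebesgue2 product_measure1E//.
  by rewrite -[RHS](mule0 (mu setT)); congr (_ * _)%E.
- by move=> z Pz; split=> //; apply: PN.
Qed.

(** By Fubini the section integrals of [|h - g|] have integral 0, so almost all of them vanish, and
    they dominate the difference of the degrees. *)
Lemma ae_eq_degree (h g : R * R -> R) : bounded_mfun Q h -> bounded_mfun Q g ->
  {ae mu2, forall z, Q z -> h z = g z} ->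
  {ae mu, forall x, U x -> degree h x = degree g x}.
Proof.
move=> bh bg hg.
have mQ := @measurable_unit_square R; have fQ := @lebesgue2_unit_square_lty R.
have mU := @measurable_unit_interval R; have fU := @lebesgue_unit_interval_lty
  R.
have bD : bounded_mfun Q (fun z => `|h z - g z|).
  by apply: bounded_mfun_norm; exact: bounded_mfunB.
have ID : \int[mu2]_(z in Q) `|h z - g z| = 0.
  rewrite /Rintegral (ae_eq_integral (cst 0%E)) ?integral0//.
    by have [] := bD => mD _; exact/measurable_EFinP.
  by apply: filterS hg => z hz Qz; rewrite hz// subrr normr0.
rewrite Rintegral_unit_square// in ID.
have bI := bounded_mfun_Rintegral bD.
have I0 x : U x -> 0 <= \int[mu]_(y in U) `|h (x, y) - g (x, y)|.
  by move=> _; exact: Rintegral_ge0.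
apply: filterS (Rintegral_eq0_ae mU fU bI I0 ID) => x H Ux; apply/eqP;
  rewrite -subr_eq0 -normr_le0 -(H Ux).
have bhx := bounded_mfun_section bh Ux; have bgx := bounded_mfun_section bg Ux.
rewrite /degree -bounded_RintegralB//; apply: le_normr_Rintegral => //.
by apply: bounded_mfun_integrable => //; exact: bounded_mfunB.
Qed.

(** The blocks are the level sets of [w], up to a null set of the line, which only affects a null
    set of the plane. *)
Lemma multipodal_finite_values (h : R * R -> R) (w : R -> R) (k : R -> R -> R)
    (Z : set R) : finite_set Z -> measurable_fun U w ->
  {ae mu, forall x, U x -> Z (w x)} ->
  {ae mu2, forall z, Q z -> h z = k (w z.1) (w z.2)} -> multipodal h.
Proof.
move=> finZ mw wZ hk.
have mU := @measurable_unit_interval R.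
have mZ : measurable (Z : set (measurableTypeR R)).
  by apply: countable_measurable (finite_set_countable finZ) => x;
    exact: measurable_set1.
(* [v] agrees with [w] off the null set [w @^-1` ~` Z] and is constant on it. *)
pose v := (id \_ Z) \o w.
have mv : measurable_fun U v.
  apply: measurableT_comp mw; apply/(measurable_restrictT id mZ).
  exact: measurable_id.
have finv : finite_set (v @` U).
  apply: (@sub_finite_set _ _ (Z `|` [set point])).
    move=> _ [x Ux <-]; rewrite /v/= patchE; case: ifPn => [/set_mem|_];
      by [left|right].
  by rewrite finite_setU; split=> //; exact: finite_set1.
have /finite_seqP[s0 s0E] := finv.
(* Without repetitions, distinct indices name distinct values, so the blocks are disjoint; listing
   only values attained on [U] makes them nonempty. *)
pose s := undup s0.
have sE : v @` U = [set` s].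
  by rewrite s0E; apply/seteqP; split=> x /=; rewrite mem_undup.
pose A (i : 'I_(size s)) := U `&` v @^-1` [set s`_i].
have AE (i j : 'I_(size s)) x : A i x -> A j x -> i = j.
  move=> [_ /= vi] [_ /= vj]; apply/val_inj/eqP.
  by rewrite -(nth_uniq 0 (ltn_ord i) (ltn_ord j) (undup_uniq s0)) -vi -vj.
exists (size s), A; split.
- split.
  + apply/seteqP; split=> [x [i _ []]//|x Ux].
    have : [set` s] (v x) by rewrite -sE; exists x.
    move=> /= vs; exists (Ordinal (eqbRL (index_mem _ _) vs)) => //.
    by split=> //=; rewrite nth_index.
  + by move=> i j _ _ [x [/AE Ai /Ai]].
  + move=> i _; have : [set` s] s`_i by apply: mem_nth.
    by rewrite -sE => -[x Ux vx]; exists x.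
- by move=> i; apply: mv.
- move=> i j; exists (k s`_i s`_j).
  have := lebesgue2_ae_snd wZ; have := lebesgue2_ae_fst wZ.
  apply: filterS3 hk => z hz Z1 Z2 [[U1 v1] [U2 v2]].
  have vw x : Z (w x) -> v x = w x by move=> Zx; rewrite /v/= patchE mem_set.
  by rewrite hz// -(vw _ (Z1 U1)) -(vw _ (Z2 U2)) v1 v2.
Qed.

Lemma multipodal_cst (h : R * R -> R) (c : R) :
  {ae mu2, forall z, Q z -> h z = c} -> multipodal h.
Proof.
move=> hc; apply: (@multipodal_finite_values h (cst c) (fun x _ => x) [set c])
  => //.
by apply: filterE.
Qed.
End multipodal.

(** * Identification of the optimizer with a Gibbs graphon *)

Theorem proposition15 (R : realType) (p : nat) (hp : (2 <= p)%N)
    (eps beta2 : R) (heps : 0 <= eps <= 1) (h : R * R -> R)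
    (hopt : optimizing_graphon p eps beta2 h) : multipodal h.
Proof.
have [gh he _] := hopt; have [_ h01 hsym] := gh;
  have bh := graphon_bounded_mfun gh.
have mQ := @measurable_unit_square R; have fQ := @lebesgue2_unit_square_lty R.
have mU := @measurable_unit_interval R; have fU := @lebesgue_unit_interval_lty
  R.
have [e0 e1] := andP heps.
(* The extreme densities force [h] to be constant almost everywhere; they are set apart because a
   Gibbs graphon has density strictly between 0 and 1. *)
have [eps0|epsn0] := eqVneq eps 0.
  apply: (@multipodal_cst _ _ 0); apply: Rintegral_eq0_ae => //.
    by move=> z /h01 /andP[].
  by rewrite -/(edge_density h) he.
have [eps1|epsn1] := eqVneq eps 1.
  apply: (@multipodal_cst _ _ 1).
  have b1h : bounded_mfun (unit_square R) (fun z => 1 - h z).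
    by apply: bounded_mfunB => //; exact: bounded_mfun_cst.
  have : {ae lebesgue2 R, forall z, unit_square R z -> 1 - h z = 0}.
    apply: Rintegral_eq0_ae => //; first by move=> z /h01 /andP[_];
      rewrite subr_ge0.
    rewrite bounded_RintegralB//; last exact: bounded_mfun_cst.
    rewrite -/(edge_density h) he eps1 Rintegral_cst1 ?subrr//.
    exact: lebesgue2_unit_square.
  by apply: filterS => z H /H /subr0_eq.
have eps01 : 0 < eps < 1 by rewrite !lt_neqAle e0 e1 epsn1 eq_sym epsn0.
(* From here [p] is [n.+1], so the exponent [n] stands for p - 1. *)
case: p hp hopt => [//|[//|m]] _; set n := m.+1 => hopt.
pose c := beta2 * n.+1%:R; pose d := degree h.
have dX01 x : unit_interval R x -> 0 <= d x ^+ n <= 1.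
  by move=> /(degree_itv gh)/andP[d0 d1]; rewrite exprn_ge0//= exprn_ile1.
pose w x := expR (- (c * d x ^+ n)).
have wb x : unit_interval R x -> expR (- `|c|) <= w x <= expR `|c|.
  move=> Ux; rewrite !ler_expR -ler_norml normrN normrM ler_piMr//.
  by have /andP[? ?] := dX01 x Ux; rewrite ger0_norm.
have w0 x : 0 < w x by exact: expR_gt0.
have bw : bounded_mfun (unit_interval R) w.
  split; last by exists (expR `|c|) => x /wb /andP[_];
    rewrite (gtr0_norm (w0 x)).
  apply: measurableT_comp; first exact: measurable_expR.
  apply: measurableT_comp; first exact: oppr_measurable.
  have [mX _] := bounded_mfunX n (degree_bounded_mfun gh).
  by apply: measurable_funM => //; exact: measurable_cst.
have bww : bounded_mfun (unit_square R) (fun z => w z.1 * w z.2).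
  by apply: bounded_mfunM; [exact: bounded_mfun_fst|exact: bounded_mfun_snd].
have [K K0 Keps] : exists2 K, 0 < K &
    \int[lebesgue2 R]_(z in unit_square R) (1 + K * (w z.1 * w z.2))^-1 = eps.
  apply: (@exists_logistic_density _ _ (expR (- `|c|) * expR (- `|c|))
    (expR `|c| * expR `|c|)) => //.
  move=> z [/wb/andP[a1 b1] /wb/andP[a2 b2]].
  by rewrite !ler_pM// ltW// expR_gt0.
pose g z := (1 + K * (w z.1 * w z.2))^-1.
have Kww0 z : 0 < K * (w z.1 * w z.2) by rewrite !mulr_gt0.
have g01 z : unit_square R z -> 0 < g z < 1.
  by move=> _; have := Kww0 z => H; rewrite invr_gt0 invf_lt1 ?ltrDl ?addr_gt0.
have bg : bounded_mfun (unit_square R) g.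
  apply: bounded_mfun_inv1D; last by move=> z _; exact: ltW.
  by apply: bounded_mfunM => //; exact: bounded_mfun_cst.
have gg : graphon g.
  split; first by have [] := bg.
  - by move=> z /g01/andP[/ltW -> /ltW ->].
  - by move=> x y _; rewrite /g/= [w x * _]mulrC.
have hg : {ae lebesgue2 R, forall z, unit_square R z -> h z = g z}.
  (* Since [1 - g z = K * (w z.1 * w z.2) * g z], the log-odds of [g] are
     [- ln K - ln (w z.1) - ln (w z.2)]; hence the multiplier [- ln K]. *)
  apply: (@optimizing_graphon_unique _ n eps beta2 (- ln K)) => // z _.
  have Kz := Kww0 z.
  have -> : 1 - g z = K * (w z.1 * w z.2) * g z.
    by rewrite /g; field; rewrite gt_eqF// addr_gt0.
  rewrite [ln (_ * g z)]lnM ?posrE ?invr_gt0 ?addr_gt0//.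
  rewrite lnM ?posrE ?mulr_gt0// lnM ?posrE// !expRK -/c -/(d _); ring.
have dg := ae_eq_degree bh bg hg.
pose G t := \int[@lebesgue_measure R]_(y in unit_interval R) (1 + K * w y *
  t)^-1.
have gG x : degree g x = G (w x).
  by apply: eq_Rintegral => y _; rewrite /g/= mulrA mulrAC.
have bKw : bounded_mfun (unit_interval R) (fun y => K * w y).
  by apply: bounded_mfunM => //; exact: bounded_mfun_cst.
have G01 t : 0 < t -> `|G t| <= 1.
  move=> t0.
  have H y : 1 <= 1 + K * w y * t by rewrite lerDl !mulr_ge0// ltW.
  apply: Rintegral_bounded => //; first exact: lebesgue_unit_interval.
    have [] // := @bounded_mfun_inv1D _ _ _ (unit_interval R) (fun y => K * w y
      * t).
      by apply: bounded_mfunM => //; exact: bounded_mfun_cst.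
    by move=> y _; rewrite !mulr_ge0// ltW.
  move=> y _; rewrite ger0_norm ?invr_ge0 ?invf_le1 ?(lt_le_trans ltr01)//.
  exact: le_trans ler01 (H y).
(* For almost every [x] one has [d x = degree g x = G (w x)], and [ln (w x) = - (c * d x ^+ n)] by
   definition, so [w x] is a zero of [f]. *)
pose f t := ln t + c * G t ^+ n.
pose Z := [set t | expR (- `|c|) <= t <= expR `|c| /\ f t = 0].
have finZ : finite_set Z.
  apply: analytic_zeros_finite; first exact: expR_gt0.
    move=> t t0; apply: analytic_atD; first exact: analytic_at_ln.
    apply: analytic_atM; first exact: analytic_at_cst.
    apply: analytic_atX; apply: analytic_at_logistic_Rintegral => // y _.
    by rewrite mulr_gt0.
  (* Beyond [expR (|c| + 1)] the logarithm is at least [|c| + 1], while the other term of [f] is at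
     most [|c|] in absolute value. *)
  move=> x; exists (Num.max x (expR (`|c| + 1))); first by rewrite le_max lexx.
  set t := Num.max _ _.
  have tc : expR (`|c| + 1) <= t by rewrite le_max lexx orbT.
  have t0 : 0 < t by apply: lt_le_trans tc; exact: expR_gt0.
  have lnt : `|c| + 1 <= ln t by rewrite -ler_expR lnK.
  have : `|c * G t ^+ n| <= `|c|.
    by rewrite normrM normrX ler_piMr// exprn_ile1// G01.
  by move=> /ler_normlP[H1 H2]; rewrite gt_eqF// /f; lra.
apply: (@multipodal_finite_values _ h w (fun a b => (1 + K * (a * b))^-1) Z) =>
  //.
  by have [] := bw.
apply: filterS dg => x dgx Ux; split; first exact: wb.
by rewrite /f -gG -dgx// /w expRK addNr.
Qed.
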